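(* Let $(X,\mathcal A,T,\mu)$ be a dynamical system and let $f:X\to Y\subset\mathbb R^N$ be an observation (a measurable function) such that $\underline C_{f_*\mu}>0$. Then for $\mu\otimes\mu$-almost every $(x,y)\in X\times X$, $$\limsup_{n\to\infty}\frac{\log m_n^f(x,y)}{-\log n}\le\frac{2}{\underline C_{f_*\mu}}.$$
   Context: A dynamical system $(X,\mathcal A,T,\mu)$ consists of a metric space $(X,d)$, a $\sigma$-algebra $\mathcal A$ on $X$, a measurable map $T:X\to X$ and a $T$-invariant probability measure $\mu$ on $(X,\mathcal A)$, i.e. $\mu(T^{-1}A)=\mu(A)$ for all $A\in\mathcal A$. The shortest distance between two observed orbits is $$m_n^f(x,y)=\min_{i,j=0,\dots,n-1} d\big(f(T^ix),f(T^jy)\big),$$ where $d$ on $Y\subset\mathbb R^N$ is the distance of $\mathbb R^N$ (with $\log 0=-\infty$). The pushforward measure is $f_*\mu(\cdot)=\mu(f^{-1}(\cdot))$. For a probability measure $\nu$ on a metric space $Z$, the lower and upper correlation dimensions are $$\underline C_\nu=\liminf_{r\to0}\frac{\log\int_Z\nu(B(z,r))\,d\nu(z)}{\log r},\qquad \overline C_\nu=\limsup_{r\to0}\frac{\log\int_Z\nu(B(z,r))\,d\nu(z)}{\log r},$$ where $B(z,r)$ is the ball of center $z$ and radius $r$. *)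

(* Defs.v *)
From HB Require Import structures.
From mathcomp Require Import all_boot all_order all_algebra.
From mathcomp Require Import all_classical all_reals all_analysis.
From mathcomp Require Import ring lra.

Set Implicit Arguments.
Unset Strict Implicit.
Unset Printing Implicit Defensive.

Import Order.TTheory GRing.Theory Num.Theory.
Import numFieldNormedType.Exports.

Local Open Scope classical_set_scope.
Local Open Scope ring_scope.

(* [measurableType] is pointed in the library, hence the pointed variant for
   the metric spaces carrying a Borel sigma-algebra. *)
#[short(type="pmetricType")]
HB.structure Definition PointedMetric (R : numDomainType) :=
  {M of Metric R M & isPointed M}.

(* A metric space with a sigma-algebra; no compatibility is required. *)
#[short(type="measurableMetricType")]
HB.structure Definition MeasurableMetric (d : measure_display)
    (R : numDomainType) :=
  {X of Measurable d X & Metric R X}.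

(* R^N as a metric space for the Euclidean distance. The alias is needed
   because the library equips ['rV[R]_N] with the sup norm. *)
Definition euclidean (R : realType) (N : nat) : Type := 'rV[R]_N.

Definition eucl_dist (R : realType) (N : nat) (u v : euclidean R N) : R :=
  Num.sqrt (\sum_(i < N) ((u : 'rV[R]_N) ord0 i - (v : 'rV[R]_N) ord0 i) ^+ 2).

Section euclidean_metric.
Variables (R : realType) (N : nat).
Implicit Types (a b : 'I_N -> R) (u v w : euclidean R N).

Let cauchy_schwarz_sum a b :
  \sum_i a i * b i <=
  Num.sqrt (\sum_i a i ^+ 2) * Num.sqrt (\sum_i b i ^+ 2).
Proof.
have sq_ge0 c : 0 <= \sum_(i < N) c i ^+ 2 :> R.
  by apply: sumr_ge0 => i _; exact: sqr_ge0.
set A := Num.sqrt _; set B := Num.sqrt _.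
have A2 : A ^+ 2 = \sum_i a i ^+ 2 by rewrite sqr_sqrtr.
have B2 : B ^+ 2 = \sum_i b i ^+ 2 by rewrite sqr_sqrtr.
have null c i : \sum_(i < N) c i ^+ 2 = 0 :> R -> c i = 0.
  move=> /eqP; rewrite psumr_eq0; last by move=> j _; exact: sqr_ge0.
  by move=> /allP/(_ i (mem_index_enum i)); rewrite sqrf_eq0 => /eqP.
have [A0|A0] := eqVneq A 0.
  rewrite A0 mul0r big1// => i _; rewrite (null a) ?mul0r//.
  by rewrite -A2 A0 expr0n.
have [B0|B0] := eqVneq B 0.
  rewrite B0 mulr0 big1// => i _; rewrite (null b) ?mulr0//.
  by rewrite -B2 B0 expr0n.
have Ap : 0 < A by rewrite lt_neqAle eq_sym A0 sqrtr_ge0.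
have Bp : 0 < B by rewrite lt_neqAle eq_sym B0 sqrtr_ge0.
have : 0 <= \sum_i (B * a i - A * b i) ^+ 2 by apply: sq_ge0.
have -> : \sum_i (B * a i - A * b i) ^+ 2 =
    2 * (A * B) * (A * B - \sum_i a i * b i).
  transitivity (\sum_i (B ^+ 2 * a i ^+ 2 + A ^+ 2 * b i ^+ 2
                        - 2 * (A * B) * (a i * b i))).
    by apply: eq_bigr => i _; ring.
  by rewrite sumrB big_split/= -!mulr_sumr -A2 -B2; ring.
by rewrite pmulr_rge0 ?subr_ge0// !mulr_gt0.
Qed.

Let eucl_distxx u : eucl_dist u u = 0.
Proof. by rewrite /eucl_dist big1 ?sqrtr0// => i _; rewrite subrr expr0n. Qed.

Let eucl_dist_positivity u v : eucl_dist u v = 0 -> u = v.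
Proof.
move=> /eqP; rewrite sqrtr_eq0 => uv; apply/rowP => i; apply/eqP.
rewrite -subr_eq0 -sqrf_eq0 eq_le sqr_ge0 andbT; apply: le_trans uv.
by rewrite (bigD1 i)//= lerDl sumr_ge0// => j _; exact: sqr_ge0.
Qed.

Let eucl_dist_sym u v : eucl_dist u v = eucl_dist v u.
Proof. by congr Num.sqrt; apply: eq_bigr => i _; rewrite -sqrrN opprB. Qed.

Let eucl_dist_triangle v u w : eucl_dist u w <= eucl_dist u v + eucl_dist v w.
Proof.
rewrite -[leRHS]ger0_norm ?addr_ge0 ?sqrtr_ge0// -sqrtr_sqr ler_wsqrtr//.
rewrite sqrrD !sqr_sqrtr; [|by apply: sumr_ge0 => i _; exact: sqr_ge0..].
pose a i := (u : 'rV[R]_N) ord0 i - (v : 'rV[R]_N) ord0 i.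
pose b i := (v : 'rV[R]_N) ord0 i - (w : 'rV[R]_N) ord0 i.
have -> : \sum_i ((u : 'rV[R]_N) ord0 i - (w : 'rV[R]_N) ord0 i) ^+ 2 =
    \sum_i a i ^+ 2 + (\sum_i a i * b i) *+ 2 + \sum_i b i ^+ 2.
  rewrite -sumrMnl -!big_split/=; apply: eq_bigr => i _; rewrite /a /b.
  ring.
by rewrite lerD2r lerD2l lerMn2r/= cauchy_schwarz_sum.
Qed.

HB.instance Definition _ := Choice.on (euclidean R N).
HB.instance Definition _ := isPointed.Build (euclidean R N) (0 : 'rV[R]_N).
HB.instance Definition _ := isMetric.Build R (euclidean R N)
  eucl_distxx eucl_dist_positivity eucl_dist_sym eucl_dist_triangle.

End euclidean_metric.

Notation borel Z := (g_sigma_algebraType (@open Z)).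

Definition measure_preserving (d : measure_display) (R : realType)
    (X : measurableType d) (mu : probability X R) (T : X -> X) :=
  forall A : set X, measurable A -> mu (T @^-1` A) = mu A.

Section observed_orbits.
Local Open Scope ereal_scope.
Context {R : realType} {X : Type} {Z : metricType R}.

(* The value is [+oo] for n = 0. *)
Definition shortest_dist (T : X -> X) (f : X -> Z) (n : nat) (x y : X)
    : \bar R :=
  \big[mine/+oo]_(ij : 'I_n * 'I_n)
    (mdist (f (iter ij.1 T x)) (f (iter ij.2 T y)))%:E.

End observed_orbits.

Section correlation_dimension.
Local Open Scope ereal_scope.
Context {R : realType} {Z : pmetricType R}.
Variable nu : probability (borel Z) R.

Definition correlation_integral (r : R) : \bar R :=
  \int[nu]_z nu (ball (z : Z) r).

Definition lower_correlation_dim : \bar R :=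
  limf_einf (fun r => lne (correlation_integral r) / (ln r)%:E) 0^'+.

End correlation_dimension.

(* Main.v *)
Require Import Defs.
From mathcomp Require Import all_boot all_order all_algebra.
From mathcomp Require Import all_classical all_reals all_analysis.
From mathcomp Require Import measurable_realfun.
From mathcomp Require Import lra.

Import Order.TTheory GRing.Theory Num.Theory.
Import numFieldNormedType.Exports.

Local Open Scope classical_set_scope.
Local Open Scope ring_scope.
Local Open Scope ereal_scope.

(** The proof is a first-moment estimate followed by the Borel-Cantelli lemma
    along the powers of 2. Write C for the lower correlation dimension of the
    law of f and m_n for the shortest distance between the two observed orbits.

    By invariance each f o T^i has the law of f, so Tonelli's theorem gives the
    pairs with d(f(T^i x), f(T^j y)) < r a mass equal to the correlation
    integral at r ([product_measure_close_pairs]). Summing over i, j < n, the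
    event m_n < r has mass at most n^2 times this integral
    ([measure_close_orbits_le]). When k < C, the correlation integral is at most
    r^k for all small r > 0 ([correlation_integral_near_le]).

    Given s > 2/C, choose k < C with s k > 2. For n = 2^l and r = 2^(-l s) the
    masses are eventually at most 2^(l (2 - s k)), which is summable; hence
    almost surely m_(2^l) >= 2^(-l s) for all large l
    ([ae_shortest_dist_ge]). As m_n is nonincreasing in n, interpolating between
    consecutive powers of 2 bounds the upper limit by any t > s
    ([limn_esup_log_le]). It remains to let t decrease to 2/C along a
    sequence. *)

(** * Measurability of the Euclidean distance *)

Section euclidean_measurability.
Context {R : realType} {N : nat}.
Local Notation E := (euclidean R N).

Lemma mdistE (u v : E) : mdist u v = eucl_dist u v.
Proof. by []. Qed.

Lemma ler_coord_dist (u v : E) (i : 'I_N) :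
  (`|(u : 'rV[R]_N) ord0 i - (v : 'rV[R]_N) ord0 i| <= mdist u v)%R.
Proof.
rewrite mdistE /eucl_dist -sqrtr_sqr ler_wsqrtr//.
by rewrite (bigD1 i)//= lerDl sumr_ge0// => j _; exact: sqr_ge0.
Qed.

Lemma measurable_coord (i : 'I_N) :
  measurable_fun setT (fun u : borel E => (u : 'rV[R]_N) ord0 i).
Proof.
apply: (measurability _ (RGenOInfty.measurableE R)).
move=> _ [_ [a ->] <-]; rewrite setTI; apply: sub_sigma_algebra.
rewrite openE => u /=; rewrite in_itv/= andbT => au.
apply/(@nbhs_ballP R E); exists ((u : 'rV[R]_N) ord0 i - a)%R.
  by rewrite /= subr_gt0.
move=> v; rewrite ballEmdist /= => uv; rewrite in_itv/= andbT.
have := le_lt_trans (ler_coord_dist u v i) uv.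
by rewrite ltr_norml => /andP[_]; rewrite ltrD2l ltrN2.
Qed.

(** The product sigma-algebra is enough, because the distance is an expression
    in finitely many measurable coordinates. *)
Lemma measurable_mdist :
  measurable_fun setT (fun uv : borel E * borel E => mdist (uv.1 : E) uv.2).
Proof.
apply: measurableT_comp.
  by apply: continuous_measurable_fun; exact: sqrt_continuous.
apply: measurable_sum => i; apply: measurable_funX; apply: measurable_funB.
  exact: (measurableT_comp (measurable_coord i) measurable_fst).
exact: (measurableT_comp (measurable_coord i) measurable_snd).
Qed.

Lemma measurable_mdist_lt (r : R) :
  measurable [set uv : borel E * borel E | (mdist (uv.1 : E) uv.2 < r)%R].
Proof.
have := measurable_mdist measurableT `]-oo, r[%classic (measurable_itv _).
by rewrite setTI; congr measurable; apply/seteqP; split => uv /=; rewrite in_itv.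
Qed.

End euclidean_measurability.

(** * Pairs of points with close images *)

Section close_pairs.
Context {R : realType} {d : measure_display} {X : measurableType d}.
Context {N : nat}.
Local Notation E := (euclidean R N).
Variables (mu : probability X R) (nu : probability (borel E) R).

(** The pairs of points whose images by [g1] and [g2] are at distance less than
    [r]. *)
Definition close_pairs (g1 g2 : X -> E) (r : R) : set (X * X) :=
  [set xy | (mdist (g1 xy.1) (g2 xy.2) < r)%R].

Lemma measurable_close_pairs (g1 g2 : X -> borel E) (r : R) :
  measurable_fun setT g1 -> measurable_fun setT g2 ->
  measurable (close_pairs g1 g2 r).
Proof.
move=> mg1 mg2.
have mg : measurable_fun setT (fun xy : X * X => (g1 xy.1, g2 xy.2)).
  apply: measurable_fun_pair.
    exact: (measurableT_comp mg1 measurable_fst).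
  exact: (measurableT_comp mg2 measurable_snd).
by have := mg measurableT _ (measurable_mdist_lt r); rewrite setTI.
Qed.

(** The correlation integral of [nu] is the probability that two independent
    variables of law [nu] are at distance less than [r]. *)
Lemma product_measure_close_pairs (g1 g2 : X -> borel E) (r : R) :
  measurable_fun setT g1 -> measurable_fun setT g2 ->
  (forall B, measurable B -> mu (g1 @^-1` B) = nu B) ->
  (forall B, measurable B -> mu (g2 @^-1` B) = nu B) ->
  (mu \x mu) (close_pairs g1 g2 r) = correlation_integral nu r.
Proof.
move=> mg1 mg2 g1nu g2nu.
pose h (z : borel E) := nu (ball (z : E) r).
pose D := [set uv : borel E * borel E | (mdist (uv.1 : E) uv.2 < r)%R].
have sec (z : borel E) : xsection D z = ball (z : E) r.
  by rewrite ballEmdist; apply/seteqP; split => v; rewrite /xsection/= inE.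
have mball (z : E) : measurable (ball z r : set (borel E)).
  by rewrite -sec; apply: measurable_xsection; exact: measurable_mdist_lt.
have mh : measurable_fun setT h.
  rewrite (_ : h = nu \o xsection D).
    by apply: measurable_fun_xsection; exact: measurable_mdist_lt.
  by apply/funext => z /=; rewrite sec.
transitivity (\int[mu]_x h (g1 x)).
  apply: eq_integral => x _ /=.
  rewrite /h -g2nu//; congr (mu _).
  by rewrite ballEmdist; apply/seteqP; split => v; rewrite /xsection/= inE.
transitivity (\int[pushforward mu g1]_z h z).
  by rewrite ge0_integral_pushforward.
by apply: eq_measure_integral => A mA _; exact: g1nu.
Qed.

End close_pairs.

(** * Decay of the correlation integral *)

Section correlation_integral_decay.
Context {R : realType} {Z : pmetricType R}.
Variable nu : probability (borel Z) R.

Lemma correlation_integral_ge0 (r : R) : 0 <= correlation_integral nu r.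
Proof. by apply: integral_ge0. Qed.

(** The right-hand side is [r] to the power [k]. *)
Lemma correlation_integral_near_le (k : R) :
  k%:E < lower_correlation_dim nu ->
  \forall r \near 0^'+, correlation_integral nu r <= (expR (k * ln r))%:E.
Proof.
rewrite /lower_correlation_dim limf_einfE => /ereal_sup_gt[_ [V V0 <-] kV].
near=> r.
have r0 : (0 < r)%R by near: r; exact: nbhs_right_gt.
have r1 : (r < 1)%R by near: r; exact: nbhs_right_lt.
have Vr : V r by near: r; exact: V0.
have lnr : (ln r < 0)%R by rewrite ln_lt0// r0.
have {kV} : k%:E < lne (correlation_integral nu r) / (ln r)%:E.
  by apply: lt_le_trans kV _; apply: ereal_inf_lbound; exists r.
rewrite inver lt_eqF//.
have := correlation_integral_ge0 r.
case: (correlation_integral nu r) => [c| |] //.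
- rewrite lee_fin => c0; rewrite lee_fin.
  (* The logarithm of 0 is -oo, so a vanishing integral is treated apart. *)
  have [->|cn0] := eqVneq c 0%R; first by rewrite expR_ge0.
  have cp : (0 < c)%R by rewrite lt_neqAle eq_sym cn0.
  rewrite lne_EFin// -EFinM lte_fin ltr_ndivlMr// => ck.
  by rewrite -[c](@lnK R) ?posrE// ler_expR ltW.
- by move=> _ /=; rewrite lt0_mulye// lte_fin invr_lt0.
Unshelve. all: by end_near.
Qed.

End correlation_integral_decay.

(** * Mass of the pairs of orbits that come close before time n *)

Section shortest_distance.
Context {R : realType} {d : measure_display} {X : measurableType d}.
Variables (mu : probability X R) (T : {mfun X >-> X}).
Hypothesis T_mu : measure_preserving mu T.

Lemma measurable_iter (i : nat) : measurable_fun setT (iter i T).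
Proof.
elim: i => [|i ih]; first exact: measurable_id.
exact: (measurableT_comp (measurable_funPT T) ih).
Qed.

Lemma measure_preserving_iter (i : nat) (A : set X) :
  measurable A -> mu (iter i T @^-1` A) = mu A.
Proof.
elim: i A => [//|i ih] A mA.
rewrite -(T_mu _ mA); apply: (ih (T @^-1` A)).
by rewrite -[X in measurable X]setTI; exact: measurable_funPT.
Qed.

Section observation.
Context {N : nat}.
Variable (f : {mfun X >-> borel (euclidean R N)}).
Local Notation E := (euclidean R N).

(** The pairs of points for which the shortest distance up to time [n] between
    their observed orbits is less than [r]. *)
Definition close_orbits (n : nat) (r : R) : set (X * X) :=
  [set xy | shortest_dist T (f : X -> E) n xy.1 xy.2 < r%:E].

Lemma close_orbitsE (n : nat) (r : R) : close_orbits n r =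
  \big[setU/set0]_(i < n) \big[setU/set0]_(j < n)
    close_pairs (f \o iter i T : X -> E) (f \o iter j T) r.
Proof.
have bigE (F : nat -> set (X * X)) xy :
    (\big[setU/set0]_(i < n) F i) xy <-> exists2 i, (i < n)%N & F i xy.
  by rewrite -bigcup_mkord.
apply/seteqP; split => [xy /bigmin_ltP[//|[[i j] _ ijr]]|xy].
  apply/(bigE (fun i => \big[setU/set0]_(j < n) close_pairs (f \o iter i T : X -> E)
    (f \o iter j T) r)); exists i => //.
  by apply/(bigE (fun j => close_pairs (f \o iter i T : X -> E) (f \o iter j T) r));
    exists j.
move=> /(bigE (fun i => \big[setU/set0]_(j < n) close_pairs (f \o iter i T : X -> E)
  (f \o iter j T) r))[i ni].
move=> /(bigE (fun j => close_pairs (f \o iter i T : X -> E) (f \o iter j T) r))[j nj].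
by move=> ijr; apply/bigmin_ltP; right; exists (Ordinal ni, Ordinal nj).
Qed.

Lemma measurable_close_iter (i j : nat) (r : R) :
  measurable (close_pairs (f \o iter i T : X -> E) (f \o iter j T) r).
Proof.
by apply: measurable_close_pairs; apply: measurableT_comp (measurable_iter _);
  exact: measurable_funPT.
Qed.

Lemma measurable_close_orbits (n : nat) (r : R) : measurable (close_orbits n r).
Proof.
rewrite close_orbitsE; apply: bigsetU_measurable => i _.
by apply: bigsetU_measurable => j _; exact: measurable_close_iter.
Qed.

Lemma measure_close_orbits_le (n : nat) (r e : R) :
  correlation_integral (distribution mu f) r <= e%:E ->
  (mu \x mu) (close_orbits n r) <= (n%:R ^+ 2 * e)%:E.
Proof.
move=> re; rewrite close_orbitsE.
have fi (i : nat) (B : set (borel E)) : measurable B ->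
    mu ((f \o iter i T) @^-1` B) = distribution mu f B.
  move=> mB; rewrite comp_preimage measure_preserving_iter//.
  by rewrite -[X in measurable X]setTI; exact: measurable_funPT.
have mfi (i : nat) : measurable_fun setT (f \o iter i T : X -> borel E).
  by apply: measurableT_comp (measurable_iter _); exact: measurable_funPT.
have inner (i : nat) : (mu \x mu) (\big[setU/set0]_(j < n)
    close_pairs (f \o iter i T : X -> E) (f \o iter j T) r) <= (n%:R * e)%:E.
  apply: le_trans; first apply: (Boole_inequality (mu \x mu)
      (A := fun j => close_pairs (f \o iter i T : X -> E) (f \o iter j T) r)).
    by move=> j _; exact: measurable_close_iter.
  rewrite (_ : (n%:R * e)%R = \sum_(j < n) e)%R; last first.
    by rewrite sumr_const card_ord mulr_natl.
  rewrite -sumEFin; apply: lee_sum => j _.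
  apply: le_trans re.
  by rewrite -(product_measure_close_pairs _ _ _ _ _ (mfi i) (mfi j) (fi i) (fi j)).
apply: le_trans; first apply: (Boole_inequality (mu \x mu)
    (A := fun i => \big[setU/set0]_(j < n)
      close_pairs (f \o iter i T : X -> E) (f \o iter j T) r)).
  by move=> i _; apply: bigsetU_measurable => j _; exact: measurable_close_iter.
rewrite (_ : (n%:R ^+ 2 * e)%R = \sum_(j < n) (n%:R * e))%R; last first.
  by rewrite sumr_const card_ord -[RHS]mulr_natl mulrA expr2.
by rewrite -sumEFin; apply: lee_sum => i _; exact: inner.
Qed.

Lemma le_shortest_dist (n1 n2 : nat) (x y : X) : (n1 <= n2)%N ->
  shortest_dist T (f : X -> E) n2 x y <= shortest_dist T (f : X -> E) n1 x y.
Proof.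
move=> n12; apply/bigmin_geP; split; first exact: leey.
move=> [i j] _ /=.
exact: (bigmin_le _ (widen_ord n12 i, widen_ord n12 j)).
Qed.

End observation.
End shortest_distance.

(** * Almost sure lower bound along the powers of 2 *)

Section shortest_distance_ae.
Context {R : realType} {d : measure_display} {X : measurableType d}.
Variables (mu : probability X R) (T : {mfun X >-> X}).
Hypothesis T_mu : measure_preserving mu T.
Context {N : nat}.
Variable (f : {mfun X >-> borel (euclidean R N)}).
Local Notation E := (euclidean R N).

(** The lower bound is 2 to the power [- s * l], written as the [l]-th power of
    2 to the power [- s]. *)
Lemma ae_shortest_dist_ge (k s : R) :
  k%:E < lower_correlation_dim (distribution mu f) -> (0 < s)%R -> (2 < s * k)%R ->
  {ae (mu \x mu), forall xy : X * X, \forall l \near \oo,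
    ((expR (- (s * ln 2))) ^+ l)%R%:E <=
      shortest_dist T (f : X -> E) (2 ^ l) xy.1 xy.2}.
Proof.
move=> kC s0 sk.
have ln2 : (0 < ln 2 :> R)%R by rewrite ln_gt0// ltr1n.
pose q : R := expR (- (s * ln 2)).
have q0 : (0 < q)%R := expR_gt0 _.
have q1 : (`|q| < 1)%R by rewrite gtr0_norm// expR_lt1 oppr_lt0 mulr_gt0.
(* The masses to be summed decay like the powers of a = 2^(2 - s k). *)
pose a : R := expR ((2 - s * k) * ln 2).
have a0 : (0 < a)%R := expR_gt0 _.
have a1 : (`|a| < 1)%R by rewrite gtr0_norm// expR_lt1 nmulr_rlt0// subr_lt0.
have qr : (fun l => q ^+ l)%R @ \oo --> 0^'+.
  move=> A A0; have qA : \forall l \near \oo, (0 < q ^+ l)%R -> A (q ^+ l)%R.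
    exact: (cvg_expr q1 A0).
  by apply: (filterS _ qA : (\forall l \near \oo, A (q ^+ l)%R)) => l; apply;
    exact: exprn_gt0.
have /qr[l0 _ l0P] := correlation_integral_near_le _ _ kC.
(* The sequence is shifted by l0, since the bound on the correlation integral
   holds only from l0 on. *)
pose F (l : nat) : set (X * X) := close_orbits T f (2 ^ (l + l0)) (q ^+ (l + l0))%R.
have mF (l : nat) : measurable (F l) by exact: measurable_close_orbits.
have F_le (l : nat) : (mu \x mu) (F l) <= (geometric (a ^+ l0)%R a l)%:E.
  have /(measure_close_orbits_le _ _ T_mu _ (2 ^ (l + l0)))/le_trans :=
    l0P (l + l0)%N (leq_addl _ _).
  apply.
  rewrite lee_fin /geometric/= -exprD addnC lnXn// expRK.
  rewrite (_ : (2 ^ (l0 + l))%:R = expR ((l0 + l)%:R * ln 2))%R; last first.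
    by rewrite expRM_natl lnK ?posrE// natrX.
  rewrite -!expRM_natl -expRD ler_expR -mulr_natl; lra.
have F0 : (mu \x mu) (lim_sup_set F) = 0.
  apply: lim_sup_set_cvg0 => //.
  apply: (@le_lt_trans _ _ (\sum_(0 <= l <oo) (geometric (a ^+ l0)%R a l)%:E)).
    by apply: lee_nneseries => l *; [exact: measure_ge0|exact: F_le].
  rewrite (_ : (fun n => _) = EFin \o series (geometric (a ^+ l0)%R a)); last first.
    by apply/funext => n; rewrite /= /series/= sumEFin.
  rewrite EFin_lim; last exact: is_cvg_geometric_series.
  exact: ltry.
exists (lim_sup_set F); split => //.
  apply: bigcap_measurable => // n _.
  by apply: bigcup_measurable => j _.
move=> xy /= nxy n _.
apply: contrapT => nF; apply: nxy; exists (n + l0)%N => // l /= nl.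
rewrite leNgt; apply/negP => bad; apply: nF; exists (l - l0)%N => /=.
  by rewrite leq_subRL ?(leq_trans _ nl)// ?leq_addl// addnC.
by rewrite /F /close_orbits/= subnK// (leq_trans _ nl)// leq_addl.
Qed.

End shortest_distance_ae.

(** * From the powers of 2 to the upper limit *)

Section limsup.
Context {R : realType}.

Lemma limn_esup_le_near (u : (\bar R)^nat) (t : \bar R) :
  (\forall n \near \oo, u n <= t) -> limn_esup u <= t.
Proof.
move=> ut; apply: (@le_trans _ _ (ereal_sup (u @` [set n | u n <= t]))).
  by apply: ereal_inf_lbound; exists [set n | u n <= t].
by apply: ge_ereal_sup => _ [n ? <-].
Qed.

(** For 2^l <= n < 2^(l+1) the bound at 2^(l+1) loses a factor 2^s, which is
    absorbed by the gap between [s] and [t] once [n] is large. *)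
Lemma limn_esup_log_le (m : (\bar R)^nat) (s t : R) :
  (forall n1 n2, (n1 <= n2)%N -> m n2 <= m n1) -> (0 < s)%R -> (s < t)%R ->
  (\forall l \near \oo, ((expR (- (s * ln 2))) ^+ l)%R%:E <= m (2 ^ l)%N) ->
  limn_esup (fun n => lne (m n) / (- ln n%:R)%:E) <= t%:E.
Proof.
move=> m_le s0 st [l0 _ l0P]; apply: limn_esup_le_near; near=> n.
have n1 : (1 < n)%N by near: n; exact: nbhs_infty_gt.
have n0 : (0 < n)%N := ltnW n1.
have ln2 : (0 < ln 2 :> R)%R by rewrite ln_gt0// ltr1n.
have lnn : (0 < ln n%:R :> R)%R by rewrite ln_gt0// ltr1n.
have ts0 : (0 < t - s)%R by rewrite subr_gt0.
have n_large : (s * ln 2 <= (t - s) * ln n%:R)%R.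
  rewrite [leRHS]mulrC -ler_pdivrMr// -[leLHS]expRK ler_ln ?posrE ?expR_gt0 ?ltr0n//.
  by near: n; exact: nbhs_infty_ger.
have /andP[ln_ nl] := trunc_log_bounds (isT : 1 < 2)%N n0.
set l := trunc_log 2 n in ln_ nl.
have ll0 : (l0 <= l.+1)%N.
  rewrite ltnW// ltnS; apply: trunc_log_max => //.
  by near: n; exact: nbhs_infty_ge.
have l_le : (l%:R * ln 2 <= ln n%:R :> R)%R.
  rewrite mulr_natl -lnXn// ler_ln ?posrE ?exprn_gt0 ?ltr0n//.
  by rewrite -natrX ler_nat.
have : (expR (- (t * ln n%:R)))%:E <= m n.
  apply: le_trans (m_le _ _ (ltnW nl)); apply: le_trans (l0P _ ll0).
  rewrite lee_fin -expRM_natl ler_expR -natr1 mulrDl mul1r.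
  have : (s * (l%:R * ln 2) <= s * ln n%:R :> R)%R by rewrite ler_pM2l.
  lra.
have lnV : (- ln n%:R < 0 :> R)%R by rewrite oppr_lt0.
rewrite inver lt_eqF//.
case: (m n) => [c| |]//.
  rewrite lee_fin => ec.
  have c0 : (0 < c)%R := lt_le_trans (expR_gt0 _) ec.
  rewrite lne_EFin// -EFinM lee_fin ler_ndivrMr// mulrN.
  by rewrite -[leLHS]expRK ler_ln// posrE expR_gt0.
by rewrite /= lt0_mulye ?leNye// lte_fin invr_lt0.
Unshelve. all: by end_near.
Qed.

End limsup.

Theorem theorem3p2 (R : realType) (d : measure_display)
    (X : measurableMetricType d R) (mu : probability X R)
    (T : {mfun X >-> X}) (T_mu : measure_preserving mu T)
    (N : nat) (Y : set (euclidean R N))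
    (f : {mfun X >-> borel (euclidean R N)}) (fY : forall x, Y (f x))
    (C_gt0 : 0 < lower_correlation_dim (distribution mu f)) :
  {ae (mu \x mu), forall xy : X * X,
    limn_esup (fun n => lne (shortest_dist T f n xy.1 xy.2) /
                        (- ln n%:R)%:E)
    <= 2%:E / lower_correlation_dim (distribution mu f)}.
Proof.
set C := lower_correlation_dim _ in C_gt0 *.
(* This covers C = +oo, where the quotient 2 / C is 0. *)
have kC (s : R) : 2%:E / C < s%:E -> exists2 k : R, k%:E < C & (2 < s * k)%R.
  case: C C_gt0 => [c| |]//.
    rewrite lte_fin => c0; rewrite inver gt_eqF// -EFinM lte_fin => cs.
    have s0 : (0 < s)%R by apply: lt_trans cs; rewrite divr_gt0.
    have sc : (2 / s < c)%R by rewrite ltr_pdivrMr// mulrC -ltr_pdivrMr.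
    exists ((2 / s + c) / 2)%R; first by rewrite lte_fin midf_lt.
    by rewrite mulrC -ltr_pdivrMr// midf_lt.
  move=> _; rewrite invey mule0 lte_fin => s0.
  exists (2 / s + 1)%R; first exact: ltry.
  by rewrite mulrDr mulr1 mulrCA divff ?gt_eqF// mulr1 ltrDl.
have D0 : 0%E <= 2%:E / C by rewrite mule_ge0// inve_ge0 ltW.
have Dfin : 2%:E / C \is a fin_num.
  by case: C C_gt0 {kC D0} => [c| |]//; rewrite ?invey ?mule0// => c0;
    rewrite inver gt_eqF.
set D := fine (2%:E / C).
have DE : 2%:E / C = D%:E by rewrite /D fineK.
rewrite DE in D0 kC *.
have step (n : nat) : {ae (mu \x mu), forall xy : X * X,
    limn_esup (fun n => lne (shortest_dist T f n xy.1 xy.2) / (- ln n%:R)%:E)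
    <= (D + n.+1%:R^-1)%:E}.
  have n0 : (0 < n.+1%:R^-1 :> R)%R by [].
  (* An exponent strictly between 2 / C and the bound to be proved. *)
  pose s := (D + n.+1%:R^-1 / 2)%R.
  have Ds : (D < s)%R by rewrite ltrDl divr_gt0.
  have [k k_lt sk] := kC s Ds.
  have s0 : (0 < s)%R by apply: le_lt_trans Ds.
  apply: filterS (ae_shortest_dist_ge _ _ T_mu _ _ _ k_lt s0 sk) => xy.
  apply: limn_esup_log_le => //.
    by move=> n1 n2; exact: le_shortest_dist.
  by rewrite ltrD2l ltr_pdivrMr// ltr_pMr// ltr1n.
apply: filterS (ae_foralln step) => xy xyP.
apply/lee_addgt0Pr => e e0.
have [n ne] : exists n : nat, (n.+1%:R^-1 < e)%R.
  by have [n _ /(_ n (leqnn _))] := near_infty_natSinv_lt (PosNum e0); exists n.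
by apply: le_trans (xyP n) _; rewrite -EFinD lee_fin lerD2l ltW.
Qed.
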